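(* Let $N\ge2$ and let $\mu$ be a quasi-stationary Markov measure on $\mathcal K_N$ associated to $(\lambda,T)$. Let $T^{(\infty)}$ be the limit of the stochastic matrices $T^{(n)}$ (which exists and is a stochastic matrix with positive entries). Let $\lambda_\infty$ be a positive probability row vector such that $\lambda_\infty T^{(\infty)}=\lambda_\infty$. Suppose that for all $i,j\in\mathbb Z_N$, $$\sum_{n=1}^\infty n\left|T^{(n)}_{i,j}-T^{(n+1)}_{i,j}\right|<\infty.$$ Let $\mu_\infty$ be the Markov measure associated to $\lambda_\infty$ and the constant sequence with fixed matrix $T^{(\infty)}$. Then: (i) The measures $\mu$ and $\mu_\infty$ are equivalent. (ii) The monic representations of $\mathcal O_N$ associated to $\mu$ and to $\mu_\infty$ are equivalent.
   Context: $\mathbb N=\{1,2,\dots\}$, $\mathbb Z_N=\{0,1,\dots,N-1\}$, and $\mathcal K_N=\mathbb Z_N^{\mathbb N}$ is the set of infinite words $x_1x_2\dots$ over $\mathbb Z_N$, with the product topology and Borel sigma-algebra. The shift is $\sigma(x_1x_2\dots)=x_2x_3\dots$. For a finite word $I=i_1\dots i_n$, the cylinder set is $\mathcal C(I)=\{x\in\mathcal K_N:x_1=i_1,\dots,x_n=i_n\}$. Markov measures: a matrix is stochastic if each row sums to $1$. A positive probability vector is a row vector $\lambda=(\lambda_0,\dots,\lambda_{N-1})$ with $\lambda_i>0$ and $\sum_i\lambda_i=1$. Let $\lambda$ be such a vector and let $T=\{T^{(n)}\}_{n\in\mathbb N}$ be a sequence of stochastic $N\times N$ matrices with $T^{(n)}_{i,j}>0$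 for all $i,j\in\mathbb Z_N$, $n\in\mathbb N$, and such that $\lambda T^{(1)}=\lambda$. The Markov measure associated to $(\lambda,T)$ is the unique Borel probability measure $\mu$ on $\mathcal K_N$ with $$\mu(\mathcal C(i_1\dots i_n))=\lambda_{i_1}T^{(1)}_{i_1,i_2}T^{(2)}_{i_2,i_3}\cdots T^{(n-1)}_{i_{n-1},i_n}$$ for all finite words. It is quasi-stationary if $$\sum_{n=1}^\infty\left|\frac{T^{(n)}_{x_n,x_{n+1}}}{T^{(n+1)}_{x_n,x_{n+1}}}-1\right|<\infty\quad\text{for all }x_1x_2\dots\in\mathcal K_N.$$ Associated representation: a representation of the Cuntz algebra $\mathcal O_N$ on a Hilbert space is given by operators $(S_i)_{i\in\mathbb Z_N}$ with $S_i^*S_j=\delta_{ij}I$ and $\sum_{i}S_iS_i^*=I$. The (monic) representation associated to a quasi-stationary Markov measure $\mu$ with data $(\lambda,T)$ is the one on $L^2(\mu)$ given by $S_jf=f_j\,(f\circ\sigma)$, where $$f_j(x_1x_2\dots)=\delta_{j,x_1}\sqrt{\frac{\lambda_{x_2}}{\lambda_{x_1}T^{(1)}_{x_1,x_2}}F(x_2x_3\dots)},\qquad F(x_1x_2\dots)=\prod_{n=1}^\infty\frac{T^{(n)}_{x_n,x_{n+1}}}{T^{(n+1)}_{x_n,x_{n+1}}}$$ (the product converges to a number in $(0,\infty)$, and the $S_j$ do form a representation of $\mathcal O_N$). For a constant sequence of matrices, $F\equiv1$. Two measures are equivalent if they are mutually absolutely continuous. Two representations $(S_i)$ on $\mathcal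 H$ and $(S_i')$ on $\mathcal H'$ are equivalent if there is a unitary $W:\mathcal H\to\mathcal H'$ with $WS_i=S_i'W$ for all $i$. *)

(* Defs.v *)
From HB Require Import structures.
From mathcomp Require Import all_boot all_order all_algebra.
From mathcomp Require Import complex.
From mathcomp Require Import all_classical all_reals all_analysis.

Set Implicit Arguments.
Unset Strict Implicit.
Unset Printing Implicit Defensive.

Import Order.TTheory GRing.Theory Num.Theory.
Import numFieldNormedType.Exports.

Local Open Scope classical_set_scope.
Local Open Scope ring_scope.
Local Open Scope complex_scope.

HB.instance Definition _ (n : nat) := isPointed.Build 'I_n.+1 ord0.

(* The alphabet Z_N, N >= 2, is 'I_n.+2 with N = n + 2.  Positions and matrices
   are indexed from 0: [x k] is the letter x_{k+1} of the word x, and [T k] is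
   the matrix T^(k+1). *)

Definition word_space (n : nat) :=
  prod_topology (fun _ : nat => discrete_topology 'I_n.+2).

(* Infinite words with the Borel sigma-algebra of the product topology. *)
Definition words (n : nat) := g_sigma_algebraType (@open (word_space n)).

Definition word_shift (n : nat) (x : words n) : words n := fun k => x k.+1.

Definition cylinder (n m : nat) (I : m.-tuple 'I_n.+2) : set (words n) :=
  [set x | forall k : 'I_m, x k = tnth I k].

Section Markov.
Context {R : realType} {n : nat}.
Implicit Types (lam : 'rV[R]_n.+2) (T : nat -> 'M[R]_n.+2).

Definition stochastic (A : 'M[R]_n.+2) : Prop :=
  forall i, \sum_j A i j = 1.

Definition positive_probability_vector lam : Prop :=
  (forall i, 0 < lam 0 i) /\ \sum_i lam 0 i = 1.

Definition markov_data lam T : Prop :=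
  [/\ positive_probability_vector lam,
      forall k, stochastic (T k),
      forall k i j, 0 < T k i j
    & lam *m T 0 = lam].

(* Cylinders generate the Borel sigma-algebra and are closed under intersection
   (up to the empty set), so this determines mu. *)
Definition markov_measure lam T (mu : probability (words n) R) : Prop :=
  forall (m : nat) (I : m.+1.-tuple 'I_n.+2),
    mu (cylinder I) =
    (lam 0 (nth ord0 I 0) *
     \prod_(k < m) T k (nth ord0 I k) (nth ord0 I k.+1))%:E.

Definition quasi_stationary T : Prop :=
  forall x : words n,
    (\sum_(0 <= k <oo)
      (`|T k (x k) (x k.+1) / T k.+1 (x k) (x k.+1) - 1|)%:E < +oo)%E.

(* [limn] is total; the product converges in (0, +oo) when T is
   quasi-stationary. *)
Definition ratio_product T (x : words n) : R :=
  limn (fun m => \prod_(0 <= k < m)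
    (T k (x k) (x k.+1) / T k.+1 (x k) (x k.+1))).

Definition monic_weight lam T (j : 'I_n.+2) (x : words n) : R :=
  (j == x 0)%:R *
  Num.sqrt (lam 0 (x 1) / (lam 0 (x 0) * T 0 (x 0) (x 1)) *
            ratio_product T (word_shift x)).

Definition monic_rep lam T (j : 'I_n.+2) (f : words n -> R[i]) :
    words n -> R[i] :=
  fun x => (monic_weight lam T j x)%:C * f (word_shift x).

End Markov.

Definition measure_equivalent d (X : measurableType d) (R : realType)
    (mu nu : set X -> \bar R) : Prop :=
  mu `<< nu /\ nu `<< mu.

(* The complex Hilbert space L^2(mu) is handled through representatives: its
   vectors are the functions in [L2 mu], up to mu-almost everywhere equality. *)
Section L2.
Context d (X : measurableType d) (R : realType).
Implicit Types (mu nu : {measure set X -> \bar R}) (f g : X -> R[i]).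

Definition L2 mu : set (X -> R[i]) :=
  [set f | [/\ measurable_fun setT (fun x => complex.Re (f x) : R),
               measurable_fun setT (fun x => complex.Im (f x) : R)
             & (\int[mu]_x ((ComplexField.Normc.normc (f x)) ^+ 2)%:E < +oo)%E]].

Definition inner_product mu f g : R[i] :=
  (\int[mu]_x complex.Re (f x * (g x)^*)) +i*
  (\int[mu]_x complex.Im (f x * (g x)^*)).

(* W induces a unitary operator from L^2(mu) onto L^2(nu); its values outside
   [L2 mu] are irrelevant. *)
Record unitary mu nu (W : (X -> R[i]) -> (X -> R[i])) : Prop := Unitary {
  unitary_L2 : forall f, L2 mu f -> L2 nu (W f);
  unitary_ae : forall f g, L2 mu f -> L2 mu g ->
    ae_eq mu setT f g -> ae_eq nu setT (W f) (W g);
  unitary_linear : forall (a : R[i]) f g, L2 mu f -> L2 mu g ->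
    ae_eq nu setT (W (fun x => a * f x + g x))
                  (fun x => a * W f x + W g x);
  unitary_inner : forall f g, L2 mu f -> L2 mu g ->
    inner_product nu (W f) (W g) = inner_product mu f g;
  unitary_surj : forall g, L2 nu g ->
    exists2 f, L2 mu f & ae_eq nu setT (W f) g }.

Definition rep_equivalent (J : Type) mu nu
    (S S' : J -> (X -> R[i]) -> (X -> R[i])) : Prop :=
  exists2 W, unitary mu nu W &
    forall j f, L2 mu f -> ae_eq nu setT (W (S j f)) (S' j (W f)).

End L2.

(* Main.v *)
Require Import Defs.
From mathcomp Require Import all_boot all_order all_algebra.
From mathcomp Require Import complex.
From mathcomp Require Import all_classical all_reals all_analysis.
From mathcomp Require Import measurable_realfun ring.
Import Order.TTheory GRing.Theory Num.Theory.
Import numFieldNormedType.Exports.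
Local Open Scope classical_set_scope.
Local Open Scope ring_scope.

Set Implicit Arguments.
Unset Strict Implicit.
Unset Printing Implicit Defensive.

(* Put
     D(x) = lam(x_0) / lamoo(x_0) * prod_k (T_k / Too)(x_k, x_{k+1}).
   Quasi-stationarity along the words ijij... bounds every entry of the T_k away
   from 0, so Too > 0 and ln is Lipschitz on the entries; since
     sum_k |T_k - Too| <= sum_k (k + 1) |T_k - T_{k+1}| < +oo,
   the product converges absolutely, and its partial products are bounded
   uniformly in x.  On cylinders of length M + 1 the partial product up to M is
   exactly mu / muoo, so dominated convergence gives dmu = D dmuoo.  As D > 0
   the measures are equivalent, and multiplication by sqrt D is a unitary from
   L^2(mu) to L^2(muoo).  It intertwines the two representations because the
   product defining F(sigma x) telescopes: its partial products are ratios of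
   those defining D(sigma x) and D(x). *)

(** * Real and imaginary parts of complex products *)

Section complex_real_imaginary.
Context (R : realType).
Implicit Types (a : R) (z w : R[i]%C).

Lemma Re_realM a z : complex.Re (a%:C%C * z) = a * complex.Re z.
Proof. by case: z => x y /=; rewrite mul0r subr0. Qed.

Lemma Im_realM a z : complex.Im (a%:C%C * z) = a * complex.Im z.
Proof. by case: z => x y /=; rewrite mul0r addr0. Qed.

Lemma Re_mulJ z w : complex.Re (z * (w^*)%C) =
  complex.Re z * complex.Re w + complex.Im z * complex.Im w.
Proof. by case: z w => [? ?] [? ?] /=; rewrite mulrN opprK. Qed.

Lemma Im_mulJ z w : complex.Im (z * (w^*)%C) =
  complex.Im z * complex.Re w - complex.Re z * complex.Im w.
Proof. by case: z w => [? ?] [? ?] /=; rewrite mulrN addrC. Qed.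

Lemma sqr_normc z : ComplexField.Normc.normc z ^+ 2 =
  complex.Re z ^+ 2 + complex.Im z ^+ 2.
Proof. by case: z => x y /=; rewrite sqr_sqrtr ?addr_ge0 ?sqr_ge0. Qed.

End complex_real_imaginary.

(** * Measures related by a positive density, and the induced unitary between L^2 spaces *)

Section density.
Context d (X : measurableType d) (R : realType).
Context (mu nu : {finite_measure set X -> \bar R}) (D : X -> R).
Hypothesis mD : measurable_fun setT D.
Hypothesis D_gt0 : forall x, 0 < D x.
Hypothesis muE : forall A, measurable A ->
  (mu A = \int[nu]_(x in A) (D x)%:E)%E.

Let mDE : measurable_fun setT (fun x => (D x)%:E).
Proof. exact/measurable_EFinP. Qed.

Lemma density_dominated : mu `<< nu.
Proof.
apply/null_content_dominatesP => A mA nuA0; rewrite muE//.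
by apply: null_set_integral => //; exact: measurable_funTS.
Qed.

(** If [D] has integral 0 over [A], it vanishes almost everywhere on [A]; as [D] is positive
    everywhere, [A] lies inside the exceptional null set. *)
Lemma density_dominates : nu `<< mu.
Proof.
apply/null_content_dominatesP => A mA muA0.
have /(ae_eq_integral_abs nu mA (measurable_funTS mDE)) :
    (\int[nu]_(x in A) `|(D x)%:E| = 0)%E.
  rewrite -[RHS](muA0 : mu A = 0%E) muE//; apply: eq_integral => x _.
  by rewrite abse_EFin ger0_norm ?ltW.
case=> N [mN N0 AN]; apply/eqP; rewrite eq_le measure_ge0 andbT -N0.
apply: le_measure; rewrite ?inE//.
apply: subset_trans AN => x Ax /= /(_ Ax) [] D0.
by have := D_gt0 x; rewrite D0 ltxx.
Qed.

Lemma density_equivalent : measure_equivalent mu nu.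
Proof. by split; [exact: density_dominated|exact: density_dominates]. Qed.

(** [D] and the Radon-Nikodym derivative have the same integral over every measurable set, so they
    agree [nu]-almost everywhere, and the change of variables for the derivative carries over to
    [D]. *)
Lemma ge0_integral_density (f : X -> \bar R) : measurable_fun setT f ->
  (forall x, 0 <= f x)%E ->
  (\int[mu]_x f x = \int[nu]_x (f x * (D x)%:E))%E.
Proof.
move=> mf f0; have munu := density_dominated.
rewrite -(Radon_Nikodym_SigmaFinite.change_of_variables munu)//.
set g := Radon_Nikodym_SigmaFinite.f mu nu.
have ig : nu.-integrable setT g.
  exact: Radon_Nikodym_SigmaFinite.f_integrable.
have gD : ae_eq nu setT g (fun x => (D x)%:E).
  apply: integral_ae_eq => // E _ mE.
  by rewrite -Radon_Nikodym_SigmaFinite.f_integral// muE.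
have mg := measurable_int nu ig.
apply: ae_eq_integral => //; do ?exact: emeasurable_funM.
exact: ae_eqe_mul2l.
Qed.

(** Multiplication by the positive [D] commutes with taking positive and negative parts, which
    reduces to the nonnegative case. *)
Lemma integral_density (f : X -> R) : measurable_fun setT f ->
  (\int[mu]_x (f x)%:E = \int[nu]_x (f x * D x)%:E)%E.
Proof.
move=> mf; have mfE : measurable_fun setT (fun x => (f x)%:E).
  exact/measurable_EFinP.
rewrite integralE [RHS]integralE.
rewrite !ge0_integral_density//; do ?[exact: measurable_funepos|
  exact: measurable_funeneg].
by congr (_ - _)%E; apply: eq_integral => x _; rewrite !(funeposE, funenegE);
  rewrite maxe_pMl ?lee_fin ?ltW// mul0e// -?EFinN -EFinM ?mulNr.
Qed.

Definition mul_sqrt_density (f : X -> R[i]%C) (x : X) : R[i]%C :=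
  (Num.sqrt (D x))%:C%C * f x.

Let sqr_sqrtD x : Num.sqrt (D x) ^+ 2 = D x.
Proof. by rewrite sqr_sqrtr ?ltW. Qed.

Let sqrtDM x (r s : R) :
  Num.sqrt (D x) * r * (Num.sqrt (D x) * s) = r * s * D x.
Proof. by rewrite mulrACA -expr2 sqr_sqrtD mulrC. Qed.

Lemma measurable_sqrt_density : measurable_fun setT (fun x => Num.sqrt (D x)).
Proof.
apply: (measurableT_comp _ mD).
exact: (continuous_measurable_fun (@sqrt_continuous R)).
Qed.

Lemma measurable_inv_sqrt_density :
  measurable_fun setT (fun x => (Num.sqrt (D x))^-1).
Proof.
have -> : (fun x => (Num.sqrt (D x))^-1) = (fun x => D x `^ (- 2^-1)).
  by apply/funext => x; rewrite powRN powR12_sqrt ?ltW.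
exact: (measurableT_comp (measurable_powR (- 2^-1)) mD).
Qed.

Lemma L2_mul_sqrt_density f : L2 nu (mul_sqrt_density f) <-> L2 mu f.
Proof.
have ms := measurable_sqrt_density.
have sD_neq0 x : Num.sqrt (D x) != 0 by rewrite sqrtr_eq0 -ltNge.
(* Here [p] stands for [Re] or [Im]; it commutes with real scalars, so multiplying by [sqrt D] or by
   its inverse preserves measurability. *)
have mReIm (g : X -> R[i]%C) (p : R[i]%C -> R) :
    (forall (a : R) z, p (a%:C%C * z) = a * p z) ->
    measurable_fun setT (fun x => p (mul_sqrt_density g x)) <->
    measurable_fun setT (fun x => p (g x)).
  move=> pM; have -> : (fun x => p (mul_sqrt_density g x)) =
      (fun x => Num.sqrt (D x) * p (g x)).
    by apply/funext => x; rewrite pM.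
  split=> mg; last exact: measurable_funM.
  have -> : (fun x => p (g x)) =
      (fun x => (Num.sqrt (D x))^-1 * (Num.sqrt (D x) * p (g x))).
    by apply/funext => x; rewrite mulKf.
  exact: measurable_funM measurable_inv_sqrt_density mg.
have normE : measurable_fun setT (fun x => complex.Re (f x)) ->
    measurable_fun setT (fun x => complex.Im (f x)) ->
    (\int[mu]_x (ComplexField.Normc.normc (f x) ^+ 2)%:E =
     \int[nu]_x (ComplexField.Normc.normc (mul_sqrt_density f x) ^+ 2)%:E)%E.
  move=> mRe mIm; rewrite integral_density//.
    apply: eq_integral => x _; rewrite !sqr_normc Re_realM Im_realM.
    by rewrite !expr2 !sqrtDM mulrDl.
  under eq_fun do rewrite sqr_normc.
  by apply: measurable_funD; exact: measurable_funX.
have mRe := mReIm f _ (@Re_realM R).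
have mIm := mReIm f _ (@Im_realM R).
split=> -[mRef mImf]; move: (mRef) (mImf) => /mRe mRe' /mIm mIm'.
  by rewrite -normE// => fin; split.
by rewrite normE// => fin; split.
Qed.

Lemma unitary_mul_sqrt_density : unitary mu nu mul_sqrt_density.
Proof.
split.
- by move=> f /L2_mul_sqrt_density.
- move=> f g _ _ /(null_dominates_ae_eq measurableT density_dominates).
  by apply: filterS => x fg _; rewrite /mul_sqrt_density fg.
- move=> a f g _ _; apply: aeW => x _.
  by rewrite /mul_sqrt_density mulrDr mulrCA.
- move=> f g [mRf mIf _] [mRg mIg _].
  rewrite /inner_product /Rintegral !integral_density//.
  + by congr (fine _ +i* fine _)%C; apply: eq_integral => x _;
      rewrite !(Re_mulJ, Im_mulJ) !(Re_realM, Im_realM) !sqrtDM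
        ?mulrDl ?mulNr.
  + under eq_fun do rewrite Im_mulJ.
    by apply: measurable_funB; exact: measurable_funM.
  + under eq_fun do rewrite Re_mulJ.
    by apply: measurable_funD; exact: measurable_funM.
(* Division by [sqrt D] gives the preimage. *)
- move=> g L2g; pose f x := ((Num.sqrt (D x))^-1)%:C%C * g x.
  have fg : mul_sqrt_density f = g.
    apply/funext => x; rewrite /mul_sqrt_density /f mulrA -rmorphM/=.
    by rewrite divff ?mul1r// sqrtr_eq0 -ltNge.
  exists f; last by rewrite fg; exact: ae_eq_refl.
  by apply/L2_mul_sqrt_density; rewrite fg.
Qed.

End density.

(** * Sets of words determined by finitely many letters *)

Section words.
Context (n : nat).
Implicit Types (x y : words n) (A U : set (words n)) (m : nat).

Definition agree m x y := forall k, (k < m)%N -> x k = y k.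

(** These are the unions of cylinders of length [m]. Over all [m] they are closed under
    intersection, with no exception for the empty set. *)
Definition finitary m A := forall x y, agree m x y -> A x -> A y.

Lemma finitaryW m p A : (m <= p)%N -> finitary m A -> finitary p A.
Proof. by move=> mp fA x y xy; apply: fA => k /leq_trans/(_ mp)/xy. Qed.

Lemma near_agree m (x : word_space n) : \forall y \near x, agree m x y.
Proof.
suff : \forall y \near x, forall k : 'I_m, x k = (y : word_space n) k.
  by apply: filterS => y xy k km; exact: (xy (Ordinal km)).
have near_coord := @filter_forall _ 'I_m
  (fun k (y : word_space n) => x k = y k) (nbhs x) _.
apply: near_coord => k.
have /(_ x) := @proj_continuous nat (fun=> discrete_topology 'I_n.+2) k.
by apply; rewrite /= nbhs_principalE => _ ->.
Qed.

Lemma open_finitary m A : finitary m A -> open (A : set (word_space n)).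
Proof.
move=> fA; rewrite openE => x Ax.
by apply: filterS (near_agree m x) => y xy; exact: fA Ax.
Qed.

Lemma measurable_finitary m A : finitary m A -> measurable A.
Proof. by move=> fA; apply: sub_sigma_algebra; exact: open_finitary fA. Qed.

(** If [x] in [U] lay in none of these sets, there would be words [y m] outside [U] sharing [m]
    letters with [x]; they converge to [x], against openness. *)
Lemma open_bigcup_finitary U : open (U : set (word_space n)) ->
  U = \bigcup_m [set x | forall y, agree m x y -> U y].
Proof.
move=> oU; apply/seteqP; split=> [x Ux|x [m _ xU]]; last exact: xU.
apply: contrapT => /= xU.
have /choice[y yP] : forall m, exists y, agree m x y /\ ~ U y.
  move=> m; apply: contrapT => xmU; apply: xU; exists m => // y xy.
  by apply: contrapT => Uy; apply: xmU; exists y.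
suff /(_ U) : (y : nat -> word_space n) @ \oo --> (x : word_space n).
  move=> /(_ (open_nbhs_nbhs (conj oU Ux))) [m _ /(_ m (leqnn m))].
  exact: (yP m).2.
apply/cvg_sup => k V [_ [[W _ <-] Wx sWV]].
exists k.+1 => // m km; apply: sWV => /=.
by rewrite -((yP m).1 k km).
Qed.

Definition finitary_sets : set (set (words n)) :=
  [set A | exists m, finitary m A].

Lemma measurable_wordsE : @measurable _ (words n) = <<s finitary_sets >>.
Proof.
apply/seteqP; split; last first.
  apply: smallest_sub; first exact: sigma_algebra_measurable.
  by move=> A [m]; exact: measurable_finitary.
apply: smallest_sub; first exact: smallest_sigma_algebra.
move=> U /open_bigcup_finitary ->.
have [_ _] := smallest_sigma_algebra setT finitary_sets; apply => m.
apply: sub_sigma_algebra; exists m => x y xy xU z yz; apply: xU => k km.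
by rewrite xy// yz.
Qed.

Lemma setI_closed_finitary : setI_closed finitary_sets.
Proof.
move=> A B [m fA] [p fB]; exists (maxn m p) => x y xy [Ax Bx]; split.
  by apply: (finitaryW (leq_maxl m p)) Ax.
by apply: (finitaryW (leq_maxr m p)) Bx.
Qed.

(** Uniqueness of finite measures on a generating family closed under intersection. *)
Lemma finitary_measure_unique (R : realType)
    (mu nu : {measure set (words n) -> \bar R}) :
    (mu setT < +oo)%E -> (forall m A, finitary m A -> mu A = nu A) ->
  forall A, measurable A -> mu A = nu A.
Proof.
move=> muT mu_nu; apply: (measure_unique finitary_sets (fun=> setT)) => //.
- exact: measurable_wordsE.
- exact: setI_closed_finitary.
- by move=> _; exists 0%N.
- by rewrite bigcup_const.
- by move=> A [m]; exact: mu_nu.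
Qed.

Lemma finitary_measurable_fun d (V : measurableType d) (f : words n -> V) m :
  (forall x y, agree m x y -> f x = f y) -> measurable_fun setT f.
Proof.
move=> fm _ Y mY; rewrite setTI; apply: (@measurable_finitary m).
by move=> x y xy; rewrite /preimage/= (fm _ _ xy).
Qed.

Lemma finitary_cylinder m (I : m.-tuple 'I_n.+2) : finitary m (cylinder I).
Proof. by move=> x y xy Ix k; rewrite -xy//; exact: Ix. Qed.

Lemma trivIset_cylinder m (s : set (m.-tuple 'I_n.+2)) :
  trivIset s (@cylinder n m).
Proof.
move=> I J _ _ [x [Ix Jx]]; apply: eq_from_tnth => k.
by rewrite -Ix -Jx.
Qed.

Lemma finitary_bigsetU m A : finitary m A ->
  A = \big[setU/set0]_(I <- [seq I <- enum {: m.-tuple 'I_n.+2} |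
                             `[< cylinder I `<=` A >]]) cylinder I.
Proof.
move=> fA; apply/seteqP; split=> x.
  move=> Ax; rewrite -bigcup_seq/=; exists [tuple x k | k < m].
    rewrite /= mem_filter mem_enum andbT; apply/asboolP => y yx.
    apply: fA Ax => k km.
    by have := yx (Ordinal km); rewrite tnth_mktuple => ->.
  by move=> k; rewrite tnth_mktuple.
rewrite -bigcup_seq => -[I /=]; rewrite mem_filter => /andP[/asboolP IA _].
exact: IA.
Qed.

(** [A] is a finite disjoint union of cylinders of length [m], and [D] is constant on each of
    them. *)
Lemma finitary_density (R : realType)
    (mu nu : {finite_measure set (words n) -> \bar R}) m (D : words n -> R) :
    (forall x, 0 <= D x) ->
    (forall x y, agree m x y -> D x = D y) ->
    (forall (I : m.-tuple 'I_n.+2) x, cylinder I x ->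
       mu (cylinder I) = ((D x)%:E * nu (cylinder I))%E) ->
  forall A, finitary m A -> mu A = (\int[nu]_(x in A) (D x)%:E)%E.
Proof.
move=> D0 Dm muD A fA; have mD := finitary_measurable_fun Dm.
have mC (I : m.-tuple 'I_n.+2) : measurable (cylinder I).
  by apply: (@measurable_finitary m); exact: finitary_cylinder.
rewrite (finitary_bigsetU fA); set s := [seq _ <- _ | _].
have us : uniq s by rewrite filter_uniq ?enum_uniq.
rewrite ge0_integral_bigsetU//; first last.
- by move=> x _; rewrite lee_fin.
- by apply/measurable_EFinP/measurable_funTS.
- exact: trivIset_cylinder.
have mU : measurable (\big[setU/set0]_(I <- s) cylinder I).
  by apply: bigsetU_measurable.
(* Writing [mu] of the union as the integral of 1 lets the same additivity split both sides. *)
rewrite -[LHS]mul1e -(integral_cst mu)// ge0_integral_bigsetU//; first last.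
  exact: trivIset_cylinder.
apply: eq_bigr => I _; rewrite integral_cst// mul1e.
(* A point at which to read off the constant value of [D]: the tuple [I] continued by the letter
   0. *)
have [x Ix] : cylinder I !=set0.
  exists (fun k => nth ord0 I k) => k; exact/esym/tnth_nth.
rewrite [LHS](muD I x Ix) -integral_cst//; apply: eq_integral => y /set_mem Iy.
congr EFin; apply: Dm => k km.
by have := Ix (Ordinal km); have := Iy (Ordinal km); rewrite /= => -> ->.
Qed.

End words.

(** * From densities on cylinders to the limit density *)

Section density_limit.
Context (R : realType) (n : nat).
Context (mu nu : {finite_measure set (words n) -> \bar R}).
Context (D_ : nat -> words n -> R) (D : words n -> R) (C : R).
Hypothesis D_ge0 : forall M x, 0 <= D_ M x.
Hypothesis D_le : forall M x, D_ M x <= C.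
Hypothesis D_agree : forall M x y, agree M.+1 x y -> D_ M x = D_ M y.
Hypothesis D_cvg : forall x, D_ ^~ x @ \oo --> D x.
Hypothesis muD : forall M (I : M.+1.-tuple 'I_n.+2) x, cylinder I x ->
  mu (cylinder I) = ((D_ M x)%:E * nu (cylinder I))%E.

Let mD_ M : measurable_fun setT (D_ M).
Proof. exact: finitary_measurable_fun (@D_agree M). Qed.

Lemma measurable_density_limit : measurable_fun setT D.
Proof. by apply: (measurable_fun_cvg mD_) => x _; exact: D_cvg. Qed.

Let D0 x : 0 <= D x.
Proof.
rewrite -(cvg_lim _ (@D_cvg x))//; apply: limr_ge.
  by apply/cvg_ex; exists (D x).
exact: nearW.
Qed.

Let DC x : D x <= C.
Proof.
rewrite -(cvg_lim _ (@D_cvg x))//; apply: limr_le.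
  by apply/cvg_ex; exists (D x).
exact: nearW.
Qed.

Let mDE : measurable_fun setT (fun x => (D x)%:E).
Proof. by apply/measurable_EFinP; exact: measurable_density_limit. Qed.

Let intC : nu.-integrable setT (fun=> C%:E).
Proof. exact: (finite_measure_integrable_cst nu C measurableT). Qed.

Let intD : nu.-integrable setT (fun x => (D x)%:E).
Proof.
apply: le_integrable intC => // x _.
by rewrite !abse_EFin lee_fin !ger0_norm// (le_trans (D0 x)).
Qed.

Let ind_ge0 A : (0 <= induced_charge intD A)%E.
Proof. by apply: integral_ge0 => x _; rewrite lee_fin. Qed.

(** It suffices to treat finitary [A]. There the integrals of [D_ M] converge to that of [D] by
    dominated convergence, with the constant [C] as dominating function. *)
Lemma density_limit A : measurable A -> mu A = (\int[nu]_(x in A) (D x)%:E)%E.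
Proof.
pose nuD : {measure set (words n) -> \bar R} := measure_of_charge _ ind_ge0.
apply: (@finitary_measure_unique n R mu nuD).
  by rewrite ltey_eq fin_num_measure.
move=> m {}A fA; have mA := measurable_finitary fA.
rewrite -[RHS]/(\int[nu]_(x in A) (D x)%:E)%E.
have /cvg_lim <- // : (\int[nu]_(x in A) (D_ M x)%:E)%E @[M --> \oo] -->
    (\int[nu]_(x in A) (D x)%:E)%E.
  have [] // := @dominated_convergence _ _ _ nu A mA
    (fun M x => (D_ M x)%:E) (fun x => (D x)%:E) (fun=> C%:E).
  - by move=> M; apply: measurable_funTS; exact/measurable_EFinP.
  - exact: measurable_funTS.
  - by apply: aeW => x _; apply/fine_cvgP; split; [exact: nearW|exact: D_cvg].
  - exact: integrableS intC.
  - by apply: aeW => x M _; rewrite abse_EFin lee_fin ger0_norm.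
(* Once [m <= M], the set [A] is determined by [M.+1] letters and the integral of [D_ M] over it is
   exactly [mu A]. *)
apply/esym/lim_near_cst => //; near=> M.
rewrite -(finitary_density (D_ge0 M) (@D_agree M) (@muD M))//.
apply: finitaryW fA; apply: leqW; near: M; exact: nbhs_infty_ge.
Unshelve. all: by end_near. Qed.

End density_limit.

(** * Convergence of infinite products through sums of logarithms *)

Section log_sums.
Context (R : realType).
Implicit Types (a t u : nat -> R).

Lemma eseries_bounded a : (forall k, 0 <= a k) ->
  (\sum_(0 <= k <oo) (a k)%:E < +oo)%E ->
  exists B, forall m, \sum_(0 <= k < m) a k <= B.
Proof.
move=> a0 aoo; have s0 : (0 <= \sum_(0 <= k <oo) (a k)%:E)%E.
  by apply: nneseries_ge0 => k _ _; rewrite lee_fin.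
exists (fine (\sum_(0 <= k <oo) (a k)%:E)%E) => m.
rewrite -lee_fin fineK ?ge0_fin_numE// -sumEFin.
by apply: nneseries_lim_ge => k _ _; rewrite lee_fin.
Qed.

(** Factor by factor, |u| <= 1 + |u - 1| <= exp |u - 1|. *)
Lemma prodr_le_expR u m :
  \prod_(0 <= k < m) `|u k| <= expR (\sum_(0 <= k < m) `|u k - 1|).
Proof.
rewrite expR_sum; apply: ler_prod => k _; rewrite normr_ge0/=.
apply: le_trans (expR_ge1Dx _).
by rewrite -{1}(subrK 1 (u k)) addrC (le_trans (ler_normD _ _))// normr1.
Qed.

(** The product of the ratios t_k / t_{k+1} telescopes to t_0 / t_m, which is therefore at most exp
    B. *)
Lemma ratio_bounded_below t B : (forall k, 0 < t k) ->
  (forall m, \sum_(0 <= k < m) `|t k / t k.+1 - 1| <= B) ->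
  forall m, t 0%N * expR (- B) <= t m.
Proof.
move=> t0 tB m; rewrite expRN ler_pdivrMr ?expR_gt0// mulrC -ler_pdivrMr//.
have -> : t 0%N / t m = \prod_(0 <= k < m) `|t k / t k.+1|.
  elim: m => [|m IH]; first by rewrite big_nil divff ?gt_eqF.
  rewrite big_nat_recr//= -IH ger0_norm ?divr_ge0 ?ltW//.
  by rewrite mulrA mulfVK ?gt_eqF.
by rewrite (le_trans (prodr_le_expR _ _))// ler_expR.
Qed.

Lemma weighted_sum_bounded t l B : t @ \oo --> l ->
  (forall m, \sum_(0 <= k < m) (k.+1%:R * `|t k - t k.+1|) <= B) ->
  forall m, \sum_(0 <= k < m) `|t k - l| <= B.
Proof.
move=> tl tB m.
(* By the triangle inequality, |t_i - t_{i+1}| is used once for each k <= i, that is i + 1 times: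
   this is the weight. With [m] fixed, [M] then tends to infinity. *)
have step M : \sum_(0 <= k < M) `|t k - t M| <=
    \sum_(0 <= k < M) (k.+1%:R * `|t k - t k.+1|).
  elim: M => [|M IH]; first by rewrite !big_nil.
  rewrite [leRHS]big_nat_recr//= [leLHS]big_nat_recr//=.
  rewrite -natr1 mulrDl mul1r addrA lerD2r (le_trans _ (lerD IH (lexx _)))//.
  have -> : M%:R * `|t M - t M.+1| = \sum_(0 <= k < M) `|t M - t M.+1|.
    by rewrite sumr_const_nat subn0 mulr_natl.
  rewrite -big_split/=; apply: ler_sum => k _.
  by rewrite (le_trans _ (ler_normD _ _))// addrA subrK.
have partial M : (m <= M)%N -> \sum_(0 <= k < m) `|t k - t M| <= B.
  move=> mM; apply: le_trans (tB M); apply: le_trans (step M).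
  by rewrite [leRHS](big_cat_nat _ (n := m))//= lerDl sumr_ge0.
have cv : \sum_(0 <= k < m) `|t k - t M| @[M --> \oo] -->
    \sum_(0 <= k < m) `|t k - l|.
  elim: {partial} m => [|m IH].
    by rewrite big_nil; under eq_cvg do rewrite big_nil; exact: cvg_cst.
  rewrite big_nat_recr//=; under eq_cvg do rewrite big_nat_recr//=.
  apply: cvgD => //; apply: cvg_norm; apply: cvgB => //; exact: cvg_cst.
rewrite -(cvg_lim _ cv)//; apply: limr_le.
  by apply/cvg_ex; eexists; exact: cv.
by near=> M; apply: partial; near: M; exact: nbhs_infty_ge.
Unshelve. all: by end_near. Qed.

(** For x <= y, ln (y / x) <= y / x - 1 = (y - x) / x, and x >= c. *)
Lemma ln_lipschitz (c x y : R) : 0 < c -> c <= x -> c <= y ->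
  `|ln x - ln y| <= `|x - y| / c.
Proof.
move=> c0; wlog xy : x y / x <= y => [hw cx cy|cx cy].
  have [|/ltW] := leP x y => xy; first exact: hw.
  by rewrite distrC (distrC x); exact: hw.
have x0 : 0 < x by exact: lt_le_trans cx.
have y0 : 0 < y by exact: lt_le_trans cy.
rewrite distrC (distrC x) !ger0_norm ?subr_ge0 ?ler_ln ?posrE//.
rewrite -ln_div ?posrE//.
apply: (@le_trans _ _ (y / x - 1)).
  rewrite -[in leLHS](subrK 1 (y / x)) addrC le_ln1Dx//.
  by rewrite ltrBrDl subrr divr_gt0.
have -> : y / x - 1 = (y - x) / x by rewrite mulrBl divff ?gt_eqF.
by rewrite ler_wpM2l ?subr_ge0// lef_pV2 ?posrE.
Qed.

(** The bound [B1] keeps all [t k], hence [l], above c = t_0 exp (- B1), where ln is Lipschitz with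
    constant 1 / c; the weighted bound [B2] then yields B2 / c. *)
Lemma sum_ln_ratio_bounded t l B1 B2 : (forall k, 0 < t k) -> t @ \oo --> l ->
  (forall m, \sum_(0 <= k < m) `|t k / t k.+1 - 1| <= B1) ->
  (forall m, \sum_(0 <= k < m) (k.+1%:R * `|t k - t k.+1|) <= B2) ->
  0 < l /\ exists B, forall m, \sum_(0 <= k < m) `|ln (t k / l)| <= B.
Proof.
move=> t0 tl tB1 tB2; set c := t 0%N * expR (- B1).
have c0 : 0 < c by rewrite mulr_gt0 ?expR_gt0.
have ct m : c <= t m by exact: ratio_bounded_below.
have cl : c <= l.
  rewrite -(cvg_lim _ tl)//; apply: limr_ge; first by apply/cvg_ex; exists l.
  exact: nearW.
have l0 := lt_le_trans c0 cl; split=> //; exists (B2 / c) => m.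
apply: le_trans (_ : (\sum_(0 <= k < m) `|t k - l|) / c <= _).
  rewrite mulr_suml; apply: ler_sum => k _.
  by rewrite ln_div ?posrE// ln_lipschitz.
by rewrite ler_pM2r ?invr_gt0// weighted_sum_bounded.
Qed.

Lemma bounded_series_cvg a B : (forall k, 0 <= a k) ->
  (forall m, \sum_(0 <= k < m) a k <= B) -> cvgn (series a).
Proof.
move=> a0 aB; apply: nondecreasing_is_cvgn.
  by apply: nondecreasing_series => k _ _.
by exists B => _ [m _ <-]; exact: aB.
Qed.

Lemma prod_expR_ln u m : (forall k, 0 < u k) ->
  \prod_(0 <= k < m) u k = expR (\sum_(0 <= k < m) ln (u k)).
Proof.
by move=> u0; rewrite expR_sum; apply: eq_bigr => k _; rewrite lnK ?posrE.
Qed.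

(** The product is the exponential of an absolutely convergent series, so its limit is an
    exponential too, hence positive. *)
Lemma prod_cvg_bounded u B : (forall k, 0 < u k) ->
  (forall m, \sum_(0 <= k < m) `|ln (u k)| <= B) ->
  [/\ forall m, \prod_(0 <= k < m) u k <= expR B,
      cvgn (fun m => \prod_(0 <= k < m) u k)
    & 0 < limn (fun m => \prod_(0 <= k < m) u k)].
Proof.
move=> u0 uB; have E m := prod_expR_ln m u0.
have cv : cvgn (series (fun k => ln (u k))).
  by apply: normed_cvg; exact: bounded_series_cvg uB.
have cvP : \prod_(0 <= k < m) u k @[m --> \oo] -->
    expR (limn (series (fun k => ln (u k)))).
  under eq_cvg do rewrite E.
  apply: continuous_cvg => //; exact: continuous_expR.
split.
- move=> m; rewrite E ler_expR (le_trans _ (uB m))//.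
  exact: le_trans (ler_norm _) (ler_norm_sum _ _ _).
- by apply/cvg_ex; eexists; exact: cvP.
- by rewrite (cvg_lim _ cvP)// expR_gt0.
Qed.

End log_sums.

(** * The density of [mu] with respect to [muoo], and the intertwining relation *)

Section quasi_stationary_density.
Context (R : realType) (n : nat).
Context (lam : 'rV[R]_n.+2) (T : nat -> 'M[R]_n.+2).
Context (mu : probability (words n) R).
Context (lamoo : 'rV[R]_n.+2) (Too : 'M[R]_n.+2).
Context (muoo : probability (words n) R).
Hypothesis lamT : markov_data lam T.
Hypothesis mu_markov : markov_measure lam T mu.
Hypothesis T_qs : quasi_stationary T.
Hypothesis T_lim : forall i j, T k i j @[k --> \oo] --> Too i j.
Hypothesis lamoo_pos : positive_probability_vector lamoo.
Hypothesis T_sum : forall i j,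
  (\sum_(0 <= k <oo) (k.+1%:R * `|T k i j - T k.+1 i j|)%:E < +oo)%E.
Hypothesis muoo_markov : markov_measure lamoo (fun=> Too) muoo.
Implicit Types (x y : words n).

Let T_gt0 k i j : 0 < T k i j. Proof. by have [_ _] := lamT. Qed.
Let lam_gt0 i : 0 < lam 0 i. Proof. by have [[]] := lamT. Qed.
Let lamoo_gt0 i : 0 < lamoo 0 i. Proof. by have [] := lamoo_pos. Qed.
Let init_ratio_ge0 i : 0 <= lam 0 i / lamoo 0 i.
Proof. by rewrite divr_ge0 ?ltW. Qed.

(* The words [ijij...] and [jiji...] together visit the pair [(i, j)] at every
   time. *)
Lemma entry_ratio_bounded i j : exists B, forall m,
  \sum_(0 <= k < m) `|T k i j / T k.+1 i j - 1| <= B.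
Proof.
have bounded x := @eseries_bounded _ _ (fun k => normr_ge0 _) (T_qs x).
have [B1 xB] := bounded (fun k => if odd k then j else i).
have [B2 yB] := bounded (fun k => if odd k then i else j).
exists (B1 + B2) => m; apply: le_trans (lerD (xB m) (yB m)).
rewrite -big_split/=; apply: ler_sum => k _.
by case: (odd k); rewrite /= ?lerDr ?lerDl.
Qed.

Lemma entry_log_bounded i j : 0 < Too i j /\ exists B, forall m,
  \sum_(0 <= k < m) `|ln (T k i j / Too i j)| <= B.
Proof.
have [B1 TB1] := entry_ratio_bounded i j.
have [|B2 TB2] := @eseries_bounded _ _ _ (T_sum i j).
  by move=> k; rewrite mulr_ge0.
exact: (sum_ln_ratio_bounded (fun k => T_gt0 k i j) (@T_lim i j) TB1 TB2).
Qed.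

Let Too_gt0 i j : 0 < Too i j. Proof. by have [] := entry_log_bounded i j. Qed.

Definition transition_ratio x k := T k (x k) (x k.+1) / Too (x k) (x k.+1).

Let transition_ratio_gt0 x k : 0 < transition_ratio x k.
Proof. by rewrite divr_gt0. Qed.

(** For a bound uniform in [x], each term is dominated by the sum over all the finitely many pairs
    of letters. *)
Lemma transition_log_bounded : exists B, forall x m,
  \sum_(0 <= k < m) `|ln (transition_ratio x k)| <= B.
Proof.
have /choice[B Bij] : forall ij : 'I_n.+2 * 'I_n.+2, exists B, forall m,
    \sum_(0 <= k < m) `|ln (T k ij.1 ij.2 / Too ij.1 ij.2)| <= B.
  by move=> [i j]; exact: (entry_log_bounded i j).2.
exists (\sum_ij B ij) => x m.
apply: (@le_trans _ _ (\sum_ij \sum_(0 <= k < m)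
    `|ln (T k ij.1 ij.2 / Too ij.1 ij.2)|)); last exact: ler_sum.
rewrite exchange_big/=; apply: ler_sum => k _.
by rewrite (bigD1 (x k, x k.+1))//= lerDl sumr_ge0.
Qed.

Definition ratio_limit x :=
  limn (fun m => \prod_(0 <= k < m) transition_ratio x k).

Lemma ratio_limit_spec : exists C,
  [/\ forall x m, \prod_(0 <= k < m) transition_ratio x k <= C,
      forall x, \prod_(0 <= k < m) transition_ratio x k @[m --> \oo] -->
        ratio_limit x
    & forall x, 0 < ratio_limit x].
Proof.
have [B TB] := transition_log_bounded.
have spec x := prod_cvg_bounded (transition_ratio_gt0 x) (TB x).
by exists (expR B); split=> x; have [] := spec x.
Qed.

(** The [M] factors involve the letters [x 0] to [x M], hence cylinders of length [M.+1]. *)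
Definition partial_density M x :=
  lam 0 (x 0%N) / lamoo 0 (x 0%N) * \prod_(0 <= k < M) transition_ratio x k.

Definition markov_density x := lam 0 (x 0%N) / lamoo 0 (x 0%N) * ratio_limit x.

Lemma markov_density_gt0 x : 0 < markov_density x.
Proof.
by have [C [_ _ P0]] := ratio_limit_spec; rewrite mulr_gt0 ?divr_gt0.
Qed.

Lemma partial_density_cylinder M (I : M.+1.-tuple 'I_n.+2) x : cylinder I x ->
  mu (cylinder I) = ((partial_density M x)%:E * muoo (cylinder I))%E.
Proof.
move=> Ix; have IxE k : (k <= M)%N -> nth ord0 I k = x k.
  rewrite -ltnS => kM.
  by have /= := Ix (Ordinal kM); rewrite (tnth_nth ord0).
rewrite [LHS]mu_markov muoo_markov -EFinM; congr EFin.
rewrite IxE// /partial_density big_mkord.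
(* The denominators [lamoo] and [Too] cancel factor by factor against the mass that [muoo] gives to
   the cylinder. *)
rewrite mulrACA divfK ?gt_eqF// -big_split/=; congr (_ * _).
apply: eq_bigr => k _; rewrite !IxE//; last exact: ltnW.
by rewrite divfK ?gt_eqF.
Qed.

Lemma partial_density_ge0 M x : 0 <= partial_density M x.
Proof. by rewrite mulr_ge0//; exact/ltW/prodr_gt0. Qed.

Lemma partial_density_agree M x y : agree M.+1 x y ->
  partial_density M x = partial_density M y.
Proof.
move=> xy; rewrite /partial_density xy//; congr (_ * _).
by apply: eq_big_nat => k /andP[_ kM]; rewrite /transition_ratio !xy// ltnW.
Qed.

Lemma markov_density_spec : measurable_fun setT markov_density /\
  forall A, measurable A ->
    mu A = (\int[muoo]_(x in A) (markov_density x)%:E)%E.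
Proof.
have [C [PC Pcvg _]] := ratio_limit_spec.
(* Summing the initial ratios over all letters makes the dominating constant independent of
   [x 0]. *)
have D_le M x : partial_density M x <= (\sum_i lam 0 i / lamoo 0 i) * C.
  apply: ler_pM => //; first exact/ltW/prodr_gt0.
  by rewrite (bigD1 (x 0%N))//= lerDl sumr_ge0.
have D_cvg x : partial_density ^~ x @ \oo --> markov_density x.
  by apply: cvgM => //; exact: cvg_cst.
split; first exact: measurable_density_limit partial_density_agree D_cvg.
exact: (density_limit partial_density_ge0 D_le partial_density_agree D_cvg
  partial_density_cylinder).
Qed.

(** Dividing numerator and denominator by the entry of [Too] turns them into factor [k] for the
    shifted word and factor [k.+1] for [x]. The latter product lacks the factor of index 0, which
    [transition_ratio x 0] restores. *)
Lemma ratio_product_shift x : ratio_product T (word_shift x) =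
  ratio_limit (word_shift x) * transition_ratio x 0 / ratio_limit x.
Proof.
have [C [_ Pcvg P0]] := ratio_limit_spec.
apply: cvg_lim => //.
have -> : (fun m => \prod_(0 <= k < m)
      (T k (word_shift x k) (word_shift x k.+1) /
       T k.+1 (word_shift x k) (word_shift x k.+1))) =
    (fun m => (\prod_(0 <= k < m) transition_ratio (word_shift x) k) *
      transition_ratio x 0 / (\prod_(0 <= k < m.+1) transition_ratio x k)).
  apply/funext => m; rewrite [in RHS]big_nat_recl// invfM mulrA mulfK ?gt_eqF//.
  rewrite -prodfV -big_split/=; apply: eq_bigr => k _.
  by rewrite /transition_ratio invf_div mulrA divfK ?gt_eqF.
apply: cvgM; first by apply: cvgM => //; exact: cvg_cst.
apply: cvgV; first by rewrite gt_eqF.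
rewrite (cvg_shiftS (fun m => \prod_(0 <= k < m) transition_ratio x k)).
exact: (@Pcvg x).
Qed.

Lemma ratio_product_cst x : ratio_product (fun=> Too) x = 1.
Proof.
rewrite /ratio_product.
under eq_fun do under eq_bigr do rewrite divff ?gt_eqF//.
by under eq_fun do rewrite big1_eq; rewrite lim_cst.
Qed.

(** The pointwise intertwining relation. The indicator of the first letter is common to both sides;
    under the square roots, [ratio_limit x], [lam 0 (x 0)] and the entry of [T 0] cancel on the
    left, and [lamoo 0 (x 1)] on the right. *)
Lemma monic_weight_density j x :
  Num.sqrt (markov_density x) * monic_weight lam T j x =
  monic_weight lamoo (fun=> Too) j x * Num.sqrt (markov_density (word_shift x)).
Proof.
have [C [_ _ P0]] := ratio_limit_spec.
rewrite /monic_weight mulrCA -[RHS]mulrA; congr (_ * _).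
rewrite ratio_product_shift ratio_product_cst.
rewrite -!sqrtrM; first last.
- by rewrite ltW// markov_density_gt0.
- by rewrite mulr1 divr_ge0 ?mulr_ge0// ltW.
congr Num.sqrt; rewrite /markov_density /transition_ratio /=.
by field; rewrite !gt_eqF.
Qed.

End quasi_stationary_density.

Theorem theorem4p4 (R : realType) (n : nat)
    (lam : 'rV[R]_n.+2) (T : nat -> 'M[R]_n.+2) (mu : probability (words n) R)
    (lamoo : 'rV[R]_n.+2) (Too : 'M[R]_n.+2) (muoo : probability (words n) R)
    (lamT : markov_data lam T)
    (mu_markov : markov_measure lam T mu)
    (T_qs : quasi_stationary T)
    (T_lim : forall i j, T k i j @[k --> \oo] --> Too i j)
    (lamoo_pos : positive_probability_vector lamoo)
    (lamoo_Too : lamoo *m Too = lamoo)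
    (T_sum : forall i j,
       (\sum_(0 <= k <oo) (k.+1%:R * `|T k i j - T k.+1 i j|)%:E < +oo)%E)
    (muoo_markov : markov_measure lamoo (fun=> Too) muoo) :
  measure_equivalent mu muoo /\
  rep_equivalent mu muoo (monic_rep lam T) (monic_rep lamoo (fun=> Too)).
Proof.
have [mD muD] := markov_density_spec lamT mu_markov T_qs T_lim lamoo_pos T_sum
  muoo_markov.
have D_gt0 := markov_density_gt0 lamT T_qs T_lim lamoo_pos T_sum.
split; first exact: (density_equivalent mD D_gt0 muD).
exists (mul_sqrt_density (markov_density lam T lamoo Too)).
  exact: (unitary_mul_sqrt_density mD D_gt0 muD).
(* The intertwining identity holds at every point. *)
move=> j f _; apply: aeW => x _.
rewrite /mul_sqrt_density /monic_rep !mulrA -!rmorphM/=.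
by rewrite (monic_weight_density lamT T_qs T_lim lamoo_pos T_sum).
Qed.
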